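(* Let $C\subset\mathbb{P}^n$ be a binomial variety of type $[(t_1,\epsilon_1),\dots,(t_s,\epsilon_s)]$, and suppose that the integer $t$ satisfies $$\operatorname{lcm}\left(\frac{t_1-1}{\gcd(t_1-1,\epsilon_1)},\frac{t_2-1}{\gcd(t_2-1,\epsilon_2)},\dots,\frac{t_s-1}{\gcd(t_s-1,\epsilon_s)}\right)=t-1.$$ Then $C^{\star t}=C$, and $t$ is the smallest integer $\geq 2$ for which this equality holds.
   Context: We work over $\mathbb{C}$. For points $p=[a_0:\cdots:a_n]$ and $q=[b_0:\cdots:b_n]$ of $\mathbb{P}^n$ with $a_ib_i\neq 0$ for some $i$, put $p\star q=[a_0b_0:\cdots:a_nb_n]$; if $a_ib_i=0$ for all $i$, then $p\star q$ is not defined. For varieties $V,W\subset\mathbb{P}^n$, the Hadamard product $V\star W$ is the Zariski closure of $\{p\star q: p\in V,\ q\in W,\ p\star q \text{ is defined}\}$. The Hadamard powers are $V^{\star 0}=\{[1:\cdots:1]\}$ and $V^{\star r}=V\star V^{\star(r-1)}$ for $r\ge 1$. For $I=(i_0,\dots,i_n)\in\mathbb{N}^{n+1}$, $X^I$ denotes the monomial $x_0^{i_0}\cdots x_n^{i_n}$, and $|I|=i_0+\cdots+i_n$. A binomial variety of type $[(t_1,\epsilon_1),\dots,(t_s,\epsilon_s)]$ (with integers $t_i\geq 2$ and $1\le\epsilon_i\le t_i-1$) is a projective variety $C\subset\mathbb{P}^n$ whose homogeneous ideal is generated by $$X^{I_{1,1}}-\xi_1^{\epsilon_1}X^{I_{1,2}},\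 \dots,\ X^{I_{s,1}}-\xi_s^{\epsilon_s}X^{I_{s,2}},$$ where $\xi_i$ is a primitive $(t_i-1)$-th root of unity for $i=1,\dots,s$, and $|I_{i,1}|=|I_{i,2}|$.
   Formalization: Minimality of t is proved assuming that no monomial X^{I_{i,1}} vanishes identically on C; without this it fails, e.g. for the ideal (x_0−x_1, x_0+x_1) with n≥2, where t=3 but C⋆C=C. The equality C^{⋆t}=C needs no extra assumption. *)

(* Defs.v *)
From mathcomp Require Import all_boot all_order all_algebra.
From mathcomp Require Import classical_sets reals complex.
From mathcomp Require Import mpoly.

Set Implicit Arguments.
Unset Strict Implicit.
Unset Printing Implicit Defensive.

Import GRing.Theory.
Local Open Scope ring_scope.
Local Open Scope classical_set_scope.

(* P^n as the set of lines through the origin of K^(n+1). *)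
Definition projspace (K : fieldType) (n : nat) : Type :=
  {L : {vspace 'rV[K]_n.+1} | \dim L == 1%N}.

Section Projective.
Variables (K : fieldType) (n : nat).
Implicit Types (p q : projspace K n) (a b : 'rV[K]_n.+1).
Implicit Types (f : {mpoly K[n.+1]}) (V W Z : set (projspace K n)).

(* hcoords p a means p = [a_0 : ... : a_n]. *)
Definition hcoords p : set 'rV[K]_n.+1 :=
  [set a | a != 0 /\ val p = <[a]>%VS].

Definition vanishes_at f p : Prop :=
  forall a, hcoords p a -> f.@[a 0] = 0.

Definition zero_locus (F : set {mpoly K[n.+1]}) : set (projspace K n) :=
  [set p | forall f, F f -> vanishes_at f p].

Definition zariski_closed Z : Prop :=
  exists2 F : set {mpoly K[n.+1]},
    (forall f, F f -> exists d : nat, f \is d.-homog) & Z = zero_locus F.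

Definition zariski_closure V : set (projspace K n) :=
  smallest zariski_closed V.

(* For K infinite this is the homogeneous ideal of V: all the homogeneous
   components of a polynomial in it vanish on V. *)
Definition vanishing_ideal V : set {mpoly K[n.+1]} :=
  [set f | forall p, V p -> vanishes_at f p].

Definition ideal_generated (s : nat) (g : 'I_s -> {mpoly K[n.+1]}) :
    set {mpoly K[n.+1]} :=
  [set f | exists h : 'I_s -> {mpoly K[n.+1]}, f = \sum_(i < s) h i * g i].

(* As homogeneous coordinates are nonzero, r ranges over exactly the p * q that
   are defined. *)
Definition hadamard V W : set (projspace K n) :=
  zariski_closure
    [set r | exists p q a b, [/\ V p, W q, hcoords p a, hcoords q b
                               & hcoords r (map2_mx *%R a b)]].

Fixpoint hadamard_pow V (r : nat) : set (projspace K n) :=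
  if r is r'.+1 then hadamard V (hadamard_pow V r')
  else [set p | hcoords p (const_mx 1)].

(* C is a binomial variety of type [(t_1, eps_1), ..., (t_s, eps_s)], its
   homogeneous ideal being generated by the X^(I1 i) - xi_i^eps_i X^(I2 i).
   C may be reducible. *)
Definition binomial_variety (C : set (projspace K n)) (s : nat)
    (t eps : 'I_s -> nat) (xi : 'I_s -> K) (I1 I2 : 'I_s -> 'X_{1..n.+1}) :
    Prop :=
  [/\ zariski_closed C,
      forall i, (2 <= t i)%N /\ (1 <= eps i <= t i - 1)%N,
      forall i, (t i - 1).-primitive_root (xi i),
      forall i, mdeg (I1 i) = mdeg (I2 i)
    & vanishing_ideal C =
      ideal_generated (fun i => 'X_[I1 i] - (xi i ^+ eps i) *: 'X_[I2 i])].

End Projective.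

(* Main.v *)
(* Write c_i for xi_i ^ eps_i; its order is (t_i - 1) / gcd (t_i - 1, eps_i), so
   t - 1 is the least k > 0 with c_i ^ k = 1 for all i.  Coordinatewise products
   multiply the constants of binomial equations, so the k-th Hadamard power of C
   lies in the locus of the binomials with constants c_i ^ k, and it contains the
   k-th power of every point of C.  For k = t the locus is C itself, and a point
   [a] of C is the product of [a ^ (t - 1)] and [a * (a^-1) ^ (t - 1)] where,
   with 0^-1 = 0, the second factor again lies in C.  Conversely, if C is its own
   m-th power, then a ^ m and a both satisfy the i-th binomial, so that
   c_i ^ (m - 1) = 1 as soon as the i-th monomials do not vanish at a. *)
Require Import Defs.
From mathcomp Require Import all_boot all_order all_algebra.
From mathcomp Require Import classical_sets reals complex.
From mathcomp Require Import mpoly.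

Set Implicit Arguments.
Unset Strict Implicit.
Unset Printing Implicit Defensive.

Import GRing.Theory.
Local Open Scope ring_scope.
Local Open Scope classical_set_scope.

Section HadamardBinomial.
Variables (K : fieldType) (n : nat).
Implicit Types (p q r : projspace K n) (a b : 'rV[K]_n.+1).
Implicit Types (V W : set (projspace K n)) (I : 'X_{1..n.+1}).

Lemma hcoords_ex p : exists a, hcoords p a.
Proof.
case: p => L dimL; exists (vpick L).
have vL0 : vpick L != 0 by rewrite vpick0 -dimv_eq0 (eqP dimL).
split=> //=; apply/esym/eqP.
by rewrite eqEdim -memvE memv_pick dim_vline vL0 (eqP dimL).
Qed.

Lemma hcoords_surj a : a != 0 -> exists p, hcoords p a.
Proof.
move=> a0; have dima : \dim <[a]>%VS == 1%N by rewrite dim_vline a0.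
by exists (exist _ <[a]>%VS dima).
Qed.

Lemma hcoords_inj p q a : hcoords p a -> hcoords q a -> p = q.
Proof.
move=> [_ pa] [_ qa].
by apply: val_inj; rewrite /= pa qa.
Qed.

Lemma hcoords_scale p a b :
  hcoords p a -> hcoords p b -> exists2 k, k != 0 & b = k *: a.
Proof.
move=> [a0 pa] [b0 pb]; have /vlineP[k bE] : b \in <[a]>%VS.
  by rewrite -pa pb memv_line.
exists k => //; apply: contra_neq b0 => k0.
by rewrite bE k0 scale0r.
Qed.

Lemma mevalX_scale k a I : 'X_[I].@[(k *: a) 0] = k ^+ mdeg I * 'X_[I].@[a 0].
Proof.
rewrite !mevalX mdegE expr_sum -big_split /=.
by apply: eq_bigr => i _; rewrite mxE exprMn.
Qed.

Lemma mevalX_map2 a b I :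
  'X_[I].@[(map2_mx *%R a b) 0] = 'X_[I].@[a 0] * 'X_[I].@[b 0].
Proof.
rewrite !mevalX -big_split /=.
by apply: eq_bigr => i _; rewrite mxE exprMn.
Qed.

Lemma mevalX_map_exp k a I :
  'X_[I].@[(map_mx (fun x => x ^+ k) a) 0] = 'X_[I].@[a 0] ^+ k.
Proof.
rewrite !mevalX -prodrXl.
by apply: eq_bigr => i _; rewrite mxE exprAC.
Qed.

(** With 0^-1 = 0, inversion is multiplicative on all of [K], so vanishing coordinates are covered
    too. *)
Lemma mevalX_map_inv a I : 'X_[I].@[(map_mx GRing.inv a) 0] = 'X_[I].@[a 0] ^-1.
Proof.
rewrite !mevalX -prodfV.
by apply: eq_bigr => i _; rewrite mxE exprVn.
Qed.

Lemma map_exp_neq0 k a : a != 0 -> map_mx (fun x => x ^+ k) a != 0.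
Proof.
apply: contra_neq => ak0; apply/rowP => j.
by move/rowP/(_ j): ak0; rewrite !mxE => /eqP; rewrite expf_eq0 => /andP[_ /eqP].
Qed.

Lemma hadamard_mem V W p q r a b :
    V p -> W q -> hcoords p a -> hcoords q b -> hcoords r (map2_mx *%R a b) ->
  hadamard V W r.
Proof. by move=> Vp Wq pa qb rab; apply: sub_gen_smallest; exists p, q, a, b. Qed.

Variables (s : nat) (I1 I2 : 'I_s -> 'X_{1..n.+1}).
Hypothesis deg12 : forall i, mdeg (I1 i) = mdeg (I2 i).
Implicit Types c d : 'I_s -> K.

Definition binomial_locus c : set (projspace K n) :=
  zero_locus [set f | exists i, f = 'X_[I1 i] - c i *: 'X_[I2 i]].

Lemma zariski_closed_binomial_locus c : zariski_closed (binomial_locus c).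
Proof.
exists [set f | exists i, f = 'X_[I1 i] - c i *: 'X_[I2 i]] => //.
move=> _ [i ->]; exists (mdeg (I1 i)).
by rewrite deg12 rpredB ?rpredZ ?dhomogX /= ?deg12.
Qed.

(** Rescaling the coordinates by k multiplies both monomials by the same power of k, their degrees
    being equal, so one representative decides. *)
Lemma binomial_locusP c p a : hcoords p a ->
  binomial_locus c p <->
  forall i, 'X_[I1 i].@[a 0] = c i * 'X_[I2 i].@[a 0].
Proof.
move=> pa; split=> [cp i | ca _ [i ->] b pb].
  have := cp _ (ex_intro _ i erefl) a pa.
  by rewrite mevalB mevalZ => /eqP; rewrite subr_eq0 => /eqP.
have [k _ ->] := hcoords_scale pa pb.
by rewrite mevalB mevalZ !mevalX_scale ca deg12 mulrCA subrr.
Qed.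

(** The target locus is closed, so it suffices to multiply the equations at two points. *)
Lemma hadamard_binomial_locus c d V W :
    V `<=` binomial_locus c -> W `<=` binomial_locus d ->
  hadamard V W `<=` binomial_locus (fun i => c i * d i).
Proof.
move=> Vc Wd; apply: smallest_sub; first exact: zariski_closed_binomial_locus.
move=> r [p [q [a [b [Vp Wq pa qb rab]]]]].
apply/(binomial_locusP _ rab) => i; rewrite !mevalX_map2.
have /(binomial_locusP _ pa) -> := Vc _ Vp.
by have /(binomial_locusP _ qb) -> := Wd _ Wq; rewrite mulrACA.
Qed.

Lemma hadamard_pow_binomial_locus c V k : V `<=` binomial_locus c ->
  hadamard_pow V k `<=` binomial_locus (fun i => c i ^+ k).
Proof.
move=> Vc; elim: k => [p p1 | k IHk].
  apply/(binomial_locusP _ p1) => i.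
  by rewrite !mevalX !big1 ?mulr1 // => j _; rewrite mxE expr1n.
move=> p /(hadamard_binomial_locus Vc IHk) cp f [i ->].
by apply: cp; exists i; rewrite exprS.
Qed.

Lemma hadamard_pow_mem V k p q a : V p -> hcoords p a ->
  hcoords q (map_mx (fun x => x ^+ k) a) -> hadamard_pow V k q.
Proof.
move=> Vp pa; elim: k q => [|k IHk] q qa.
  suff E : map_mx (fun x => x ^+ 0) a = const_mx 1 by rewrite E in qa.
  by apply/rowP => j; rewrite !mxE.
have [r ra] := hcoords_surj (map_exp_neq0 k (proj1 pa)).
apply: (hadamard_mem Vp (IHk _ ra) pa ra).
suff -> : map2_mx *%R a (map_mx (fun x => x ^+ k) a) =
          map_mx (fun x => x ^+ k.+1) a by [].
by apply/rowP => j; rewrite !mxE exprS.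
Qed.

Lemma sub_hadamard_pow_binomial_locus c k :
    (forall i, c i ^+ k = 1) ->
  binomial_locus c `<=` hadamard_pow (binomial_locus c) k.+1.
Proof.
move=> ck1 p cp; have [a pa] := hcoords_ex p.
pose ak := map_mx (fun x => x ^+ k) a.
pose b := map2_mx *%R a (map_mx (fun x => x ^+ k) (map_mx GRing.inv a)).
have bakE : map2_mx *%R b ak = a.
  apply/rowP => j; rewrite !mxE -mulrA -exprMn.
  (* Where a_j = 0, the leading factor a_j of [b] makes the product 0, whatever [k] is. *)
  have [->|aj0] := eqVneq (a 0 j) 0; first by rewrite mul0r.
  by rewrite mulVf // expr1n mulr1.
have b0 : b != 0.
  apply: contra_neq (proj1 pa) => b0; rewrite -bakE b0.
  by apply/rowP => j; rewrite !mxE mul0r.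
have [q qb] := hcoords_surj b0.
have [r ra] := hcoords_surj (map_exp_neq0 k (proj1 pa)).
apply: (hadamard_mem _ (hadamard_pow_mem cp pa ra) qb ra); last by rewrite bakE.
apply/(binomial_locusP _ qb) => i.
rewrite !mevalX_map2 !mevalX_map_exp !mevalX_map_inv.
have /(binomial_locusP _ pa) -> := cp.
(* The factor (a^-1)^k contributes the constant (c_i^k)^-1 = 1, so [b] keeps the constant c_i of
   [a]. *)
by rewrite invfM exprMn exprVn ck1 invr1 mul1r mulrA.
Qed.

(** The generators vanish on [C]. Conversely, the equations that cut out the closed set [C] lie in
    its ideal, hence are combinations of the generators. *)
Lemma binomial_varietyE C (ti eps : 'I_s -> nat) (xi : 'I_s -> K) :
    binomial_variety C ti eps xi I1 I2 ->
  C = binomial_locus (fun i => xi i ^+ eps i).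
Proof.
case=> [[F _ CF] _ _ _ idC]; apply/seteqP; split=> p.
  move=> Cp _ [i ->].
  suff: vanishing_ideal C ('X_[I1 i] - xi i ^+ eps i *: 'X_[I2 i]) by apply.
  rewrite idC; exists (fun j => (j == i)%:R).
  rewrite (bigD1 i) //= eqxx mul1r big1 ?addr0 // => j /negPf->.
  by rewrite mul0r.
move=> cp; rewrite CF => f Ff a pa.
have: vanishing_ideal C f by move=> q; rewrite CF; apply.
rewrite idC => -[h ->]; rewrite raddf_sum big1 // => i _.
by rewrite /= mevalM (cp _ (ex_intro _ i erefl) _ pa) mulr0.
Qed.

Lemma hadamard_pow_binomial_locus_exp1 c k i :
    hadamard_pow (binomial_locus c) k.+1 = binomial_locus c ->
    ~ vanishing_ideal (binomial_locus c) 'X_[I1 i] ->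
  c i ^+ k = 1.
Proof.
move=> powE nvan; apply/eqP/negP => /negP ck1; apply: nvan => p cp a pa.
have [q qa] := hcoords_surj (map_exp_neq0 k.+1 (proj1 pa)).
have: binomial_locus c q by rewrite -powE; apply: hadamard_pow_mem cp pa qa.
move=> /(binomial_locusP _ qa)/(_ i); rewrite !mevalX_map_exp.
have /(binomial_locusP _ pa)-> := cp.
(* With u the value of the second monomial at [a], this reads c (c^k u^(k+1)) = c u^(k+1). As c^k
   differs from 1, either c = 0 or u = 0, and the first monomial c u vanishes. *)
rewrite exprMn exprS -mulrA => /eqP.
have [->|ci0] := eqVneq (c i) 0; first by rewrite !mul0r.
rewrite (inj_eq (mulfI ci0)) -subr_eq0 -{2}[_ ^+ k.+1]mul1r -mulrBl.
by rewrite mulf_eq0 subr_eq0 (negPf ck1) expf_eq0 /= => /eqP->; rewrite mulr0.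
Qed.

End HadamardBinomial.

(* Without the nondegeneracy premise the minimality of t fails: the ideal
   (x_0 - x_1, x_0 + x_1) has type [(2, 1), (3, 1)], so t = 3, but its zero
   locus {x_0 = x_1 = 0} is its own Hadamard square. *)
Theorem theorem6p2 (R : realType) (n s : nat) (C : set (projspace R[i] n))
    (ti eps : 'I_s -> nat) (xi : 'I_s -> R[i])
    (I1 I2 : 'I_s -> 'X_{1..n.+1}) (t : nat)
    (hC : binomial_variety C ti eps xi I1 I2)
    (ht : (\big[lcmn/1]_(i < s)
             ((ti i - 1) %/ gcdn (ti i - 1) (eps i)) = t - 1)%N) :
  [/\ (2 <= t)%N,
      hadamard_pow C t = C
    & (forall i, ~ vanishing_ideal C 'X_[I1 i]) ->
      forall m : nat, (2 <= m)%N -> hadamard_pow C m = C -> (t <= m)%N].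
Proof.
have CE := binomial_varietyE hC; case: hC => _ ti2 prim deg12 _.
pose c i := xi i ^+ eps i.
have lcmP k : reflect (forall i, c i ^+ k = 1) (t - 1 %| k)%N.
  rewrite -ht; apply: (iffP (dvdn_biglcmP _ _ _)) => [ck i | ck i _].
    by apply/eqP; rewrite -(prim_order_dvd (exp_prim_root (prim i) _)) gcdnC ck.
  by rewrite gcdnC (prim_order_dvd (exp_prim_root (prim i) _)) -/(c i) ck.
(* Subtraction is truncated, so t >= 2 comes from the positivity of the lcm. *)
have t1 : (0 < t - 1)%N.
  rewrite -ht; apply: (big_ind (fun x => 0 < x)%N) => [|x y x0 y0|i _] //.
    by rewrite lcmn_gt0 x0.
  have t0 : (0 < ti i - 1)%N by rewrite subn_gt0; case: (ti2 i).
  by rewrite divn_gt0 ?gcdn_gt0 ?t0 // dvdn_leq // dvdn_gcdl.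
rewrite subn_gt0 in t1; split=> // [|nvan [//|m] m2 powE].
  have ct1 := elimT (lcmP _) (dvdnn (t - 1)).
  have tE : (t - 1).+1 = t by rewrite subn1 prednK // ltnW.
  rewrite -tE CE; apply/seteqP; split; last exact: sub_hadamard_pow_binomial_locus.
  move=> p /(hadamard_pow_binomial_locus deg12 (@subset_refl _ _)) cp f [i ->].
  by apply: cp; exists i; rewrite exprS ct1 mulr1.
(* The Hadamard exponent is now [m.+1], and [m2] says m > 0, so divisibility bounds t - 1 by m. *)
have /dvdn_leq : (t - 1 %| m)%N.
  apply/lcmP => i; apply: (hadamard_pow_binomial_locus_exp1 deg12).
    by rewrite -CE.
  by rewrite -CE.
by rewrite leq_subLR add1n; apply.
Qed.
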